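(* Let $\mathcal S\subseteq\mathbb R^d$ be a finite state space and $k\in\mathbb N$. 1. For every $P\subseteq\mathcal S^{k+1}$ there exists a differential safety property $\varphi_P$ of order $k$ such that, for every $w=s_1s_2\cdots\in\mathcal S^\infty$ and every $t$ with $k+1\le t\le|w|$, $[\![\varphi_P]\!]_t(w)=\top$ if and only if $(s_{t-k},\dots,s_t)\in P$. 2. Conversely, for every differential safety property $\varphi$ of order $k$, the value $[\![\varphi]\!]_t(w)$ (for $w\in\mathcal S^\infty$, $k+1\le t\le|w|$) depends only on the window $(s_{t-k},\dots,s_t)$.
   Context: $\mathbb N=\{0,1,2,\dots\}$. $\mathcal S^\infty$ is the set of all finite and infinite sequences over $\mathcal S$; for $w=s_1s_2\cdots\in\mathcal S^\infty$, $|w|\in\mathbb N\cup\{\infty\}$ is its length. **Discrete derivatives.** $\Delta\tau>0$ is a fixed time step. For $w=s_1s_2\cdots\in\mathcal S^\infty$, $\partial^0_t(w)=s_t$ and $\partial^k_t(w)=(\partial^{k-1}_t(w)-\partial^{k-1}_{t-1}(w))/\Delta\tau$, for $k<t\le|w|$. **Differential safety properties.** These are the formulas $\varphi::=(\partial^k\in\mathcal R)\mid\varphi\land\varphi\mid\lnot\varphi$ with $k\in\mathbb N$, $\mathcal R\subseteq\mathbb R^d$ arbitrary. The order $\mathrm{ord}(\varphi)$ is the largest $k$ occurring in an atom $(\partial^k\in\mathcal R)$ of $\varphi$. For $\mathrm{ord}(\varphi)+1\le t\le|w|$, the local value $[\![\varphi]\!]_t(w)\in\{\top,\bot\}$ is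 defined by: $[\![\partial^j\in\mathcal R]\!]_t(w)=\top$ iff $\partial^j_t(w)\in\mathcal R$, extended to Boolean connectives as usual. *)

(* Defs.v *)
From HB Require Import structures.
From mathcomp Require Import all_boot all_order all_algebra.
From mathcomp Require Import boolp classical_sets cardinality reals.

Set Implicit Arguments.
Unset Strict Implicit.
Unset Printing Implicit Defensive.

Import Order.TTheory GRing.Theory Num.Theory.

Local Open Scope classical_set_scope.
Local Open Scope ring_scope.

(* Finite and infinite sequences; [InfWord u] is u 0, u 1, u 2, ... *)
Variant word (T : Type) : Type :=
| FinWord of seq T
| InfWord of (nat -> T).

(* [None] stands for the length oo. *)
Definition wlength (T : Type) (w : word T) : option nat :=
  match w with FinWord s => Some (size s) | InfWord _ => None end.

Definition le_wlength (T : Type) (t : nat) (w : word T) : bool :=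
  match wlength w with Some n => (t <= n)%N | None => true end.

Definition words_over (T : eqType) (S : set T) : set (word T) :=
  [set w | match w with
           | FinWord s => forall x, x \in s -> S x
           | InfWord u => forall n, S (u n)
           end].

(* The letter s_t, positions being counted from 1 as in w = s_1 s_2 ...;
   the value is junk (but total) unless 1 <= t <= |w|. *)
Definition letter (V : nmodType) (w : word V) (t : nat) : V :=
  match w with FinWord s => s`_t.-1 | InfWord u => u t.-1 end.

(* (s_{t-k}, ..., s_t), meaningful for k < t <= |w|. *)
Definition window (V : nmodType) (k : nat) (w : word V) (t : nat) :
    k.+1.-tuple V :=
  [tuple letter w (t - k + i)%N | i < k.+1].

Definition tuples_over (T : Type) (S : set T) (n : nat) : set (n.-tuple T) :=
  [set p | forall i : 'I_n, S (tnth p i)].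
Arguments tuples_over {T} S n.

(* dderiv dt k w t is the k-th discrete derivative of w at t, meaningful for
   k < t <= |w|; the recursion then only reads letters s_{t-k}, ..., s_t. *)
Fixpoint dderiv (R : realType) (d : nat) (dt : R) (k : nat)
    (w : word 'rV[R]_d) (t : nat) : 'rV[R]_d :=
  match k with
  | 0%N => letter w t
  | j.+1 => dt^-1 *: (dderiv dt j w t - dderiv dt j w t.-1)
  end.

Inductive dsp (R : realType) (d : nat) : Type :=
| DAtom of nat & set 'rV[R]_d
| DAnd of dsp R d & dsp R d
| DNot of dsp R d.

Fixpoint dsp_ord (R : realType) (d : nat) (phi : dsp R d) : nat :=
  match phi with
  | DAtom k _ => k
  | DAnd phi1 phi2 => maxn (dsp_ord phi1) (dsp_ord phi2)
  | DNot phi1 => dsp_ord phi1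
  end.

(* Local value, meaningful for dsp_ord phi < t <= |w|. *)
Fixpoint dsp_val (R : realType) (d : nat) (dt : R) (phi : dsp R d)
    (t : nat) (w : word 'rV[R]_d) : bool :=
  match phi with
  | DAtom k A => dderiv dt k w t \in A
  | DAnd phi1 phi2 => dsp_val dt phi1 t w && dsp_val dt phi2 t w
  | DNot phi1 => ~~ dsp_val dt phi1 t w
  end.

(* Main.v *)
(* The derivatives of orders 0, ..., k at t and the letters s_{t-k}, ..., s_t
   determine each other, since s_{t-1} = s_t - dt * (first derivative at t),
   and likewise at every order. Hence a window p is singled out by the finite
   conjunction over j <= k of the atoms "the j-th derivative equals that of p";
   as S is finite, P is a finite disjunction of such conjunctions. *)
Require Import Defs.
From HB Require Import structures.
From mathcomp Require Import all_boot all_order all_algebra.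
From mathcomp Require Import boolp classical_sets cardinality reals.

Import Order.TTheory GRing.Theory Num.Theory.

Local Open Scope classical_set_scope.
Local Open Scope ring_scope.

Set Implicit Arguments.
Unset Strict Implicit.
Unset Printing Implicit Defensive.

(** Counts letters backwards from the right end, the direction in which [dderiv] reads them; the
    entry of index [k - i] in the window is the letter at [t - i]. *)
Lemma window_eqP (V : nmodType) (k : nat) (w w' : word V) (t t' : nat) :
  (k < t)%N -> (k < t')%N ->
  window k w t = window k w' t' <->
  (forall i, (i <= k)%N -> letter w (t - i) = letter w' (t' - i)).
Proof.
move=> kt kt'; split=> [eqw i ik|eql].
  have lt_ki : (k - i < k.+1)%N by rewrite ltnS leq_subr.
  have := congr1 (fun p => tnth p (Ordinal lt_ki)) eqw.
  rewrite !tnth_mktuple /=.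
  by rewrite !addnBA // !subnK // ltnW.
apply/eq_from_tnth => i; rewrite !tnth_mktuple.
have ik : (i <= k)%N by rewrite -ltnS.
by rewrite !addnBAC ?(ltnW kt) ?(ltnW kt') // -!subnBA // eql ?leq_subr.
Qed.

(** Lets a tuple serve as a word of its own, so that its discrete derivatives at the last position
    [k.+1] can be used as target values. *)
Lemma window_FinWord (V : nmodType) (k : nat) (p : k.+1.-tuple V) :
  window k (FinWord p) k.+1 = p.
Proof.
apply/eq_from_tnth => i.
by rewrite tnth_mktuple /letter subSnn add1n /= (tnth_nth 0).
Qed.

Section Derivatives.
Variables (R : realType) (d : nat) (dt : R).
Implicit Types (w : word 'rV[R]_d) (phi : dsp R d).

(** Induction on the order [j], for all offsets [i] at once, since order [j.+1] at offset [i] reads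
    order [j] at offsets [i] and [i.+1]. *)
Lemma eq_dderiv_of_letters (k : nat) w w' (t t' : nat) :
  (forall i, (i <= k)%N -> letter w (t - i) = letter w' (t' - i)) ->
  forall j i, (i + j <= k)%N ->
    dderiv dt j w (t - i) = dderiv dt j w' (t' - i).
Proof.
move=> eql; elim=> [|j IHj] i /=; first by rewrite addn0 => /eql.
rewrite addnS => ijk; rewrite -!subnS.
by rewrite (IHj i (ltnW ijk)) (IHj i.+1 ijk).
Qed.

(** Induction on [i]: agreement at orders [j] and [j.+1] gives agreement at order [j] one position
    earlier, by cancelling [dt^-1] and then the common term. Each step back costs one order, whence
    the bound on [i + j]. *)
Lemma eq_dderiv_pred (k : nat) w w' (t t' : nat) : dt != 0 ->
  (forall j, (j <= k)%N -> dderiv dt j w t = dderiv dt j w' t') ->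
  forall i j, (i + j <= k)%N ->
    dderiv dt j w (t - i) = dderiv dt j w' (t' - i).
Proof.
move=> dt0 eqD; elim=> [|i IHi] j; first by rewrite !subn0 add0n => /eqD.
rewrite addSn !subnS => ijk.
have := IHi j.+1; rewrite addnS => /(_ ijk) /=.
move/(scalerI (invr_neq0 dt0)); rewrite (IHi j (ltnW ijk)).
by move/addrI/oppr_inj.
Qed.

Lemma window_dderivP (k : nat) w w' (t t' : nat) : dt != 0 ->
  (k < t)%N -> (k < t')%N ->
  window k w t = window k w' t' <->
  (forall j, (j <= k)%N -> dderiv dt j w t = dderiv dt j w' t').
Proof.
move=> dt0 kt kt'; rewrite window_eqP //; split=> [eql j jk|eqD i ik].
  by rewrite -(subn0 t) -(subn0 t'); apply: eq_dderiv_of_letters eql _ _ _.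
by have := eq_dderiv_pred dt0 eqD (i := i) (j := 0); rewrite addn0; exact.
Qed.

Lemma eq_dsp_val phi w w' (t t' : nat) :
  (forall j, (j <= dsp_ord phi)%N -> dderiv dt j w t = dderiv dt j w' t') ->
  dsp_val dt phi t w = dsp_val dt phi t' w'.
Proof.
elim: phi => [j A|phi1 IH1 phi2 IH2|phi IH] /= eqD.
- by rewrite eqD.
- rewrite IH1 ?IH2 // => j jle; apply: eqD; rewrite leq_max jle ?orbT //.
- by rewrite IH.
Qed.

Fixpoint dderivs_eq (k : nat) (x : nat -> 'rV[R]_d) : dsp R d :=
  match k with
  | 0%N => DAtom 0 [set x 0%N]
  | j.+1 => DAnd (DAtom j.+1 [set x j.+1]) (dderivs_eq j x)
  end.

Lemma dsp_ord_dderivs_eq (k : nat) (x : nat -> 'rV[R]_d) :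
  dsp_ord (dderivs_eq k x) = k.
Proof. by elim: k => //= k ->; apply/maxn_idPl. Qed.

Lemma dsp_val_dderivs_eq (k : nat) (x : nat -> 'rV[R]_d) w (t : nat) :
  dsp_val dt (dderivs_eq k x) t w <->
  (forall j, (j <= k)%N -> dderiv dt j w t = x j).
Proof.
elim: k => [|k IHk].
  rewrite [dsp_val _ _ _ _]/= inE; split=> [eqx j|/(_ 0%N isT)//].
  by rewrite leqn0 => /eqP->.
rewrite [dsp_val _ _ _ _]/=; split=> [/andP[/set_mem eqx /IHk eqxs] j|eqx].
  by rewrite leq_eqVlt => /predU1P[->|/eqxs].
apply/andP; split; first by apply/mem_set; exact: (eqx k.+1).
by apply/IHk => j jk; apply/eqx/leqW.
Qed.

Definition dsp_or phi1 phi2 : dsp R d := DNot (DAnd (DNot phi1) (DNot phi2)).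

(* The base case is the unsatisfiable atom of order [k] rather than of order 0,
   so that an empty disjunction still has order [k]. *)
Definition dsp_some (k : nat) (T : Type) (f : T -> dsp R d) (s : seq T) :=
  foldr (fun x => dsp_or (f x)) (DAtom k set0) s.

Lemma dsp_ord_some (k : nat) (T : Type) (f : T -> dsp R d) (s : seq T) :
  (forall x, dsp_ord (f x) = k) -> dsp_ord (dsp_some k f s) = k.
Proof. by move=> ordf; elim: s => //= x s ->; rewrite ordf maxnn. Qed.

Lemma dsp_val_some (k : nat) (T : Type) (f : T -> dsp R d) (s : seq T)
    (t : nat) w :
  dsp_val dt (dsp_some k f s) t w = has (fun x => dsp_val dt (f x) t w) s.
Proof.
elim: s => [|x s IHs] /=; first by rewrite in_set0.
by rewrite IHs negb_and !negbK.
Qed.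

End Derivatives.

(** With [S] enumerated by [s], these tuples lie in the image of the finite type of tuples over
    [seq_sub s]. *)
Lemma finite_tuples_over (T : choiceType) (S : set T) (n : nat) :
  finite_set S -> finite_set (tuples_over S n).
Proof.
move=> /finite_seqP[s ->].
apply: (@sub_finite_set _ _
  ((fun p : n.-tuple (seq_sub s) => [tuple of map val p]) @` setT)).
  move=> p ps; exists [tuple SeqSub (ps i) | i < n] => //.
  by apply/eq_from_tnth => i; rewrite tnth_map tnth_mktuple.
exact/finite_image/finite_finset.
Qed.

Theorem lemma2 (R : realType) (d : nat) (dt : R) (dt_gt0 : 0 < dt)
    (S : set 'rV[R]_d) (finS : finite_set S) (k : nat) :
  (forall P : set (k.+1.-tuple 'rV[R]_d), P `<=` tuples_over S k.+1 ->
     exists phi : dsp R d, dsp_ord phi = k /\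
       forall (w : word 'rV[R]_d) (t : nat), words_over S w ->
         (k.+1 <= t)%N -> le_wlength t w ->
         (dsp_val dt phi t w = true <-> P (window k w t)))
  /\
  (forall phi : dsp R d, dsp_ord phi = k ->
     forall (w w' : word 'rV[R]_d) (t t' : nat),
       words_over S w -> words_over S w' ->
       (k.+1 <= t)%N -> le_wlength t w ->
       (k.+1 <= t')%N -> le_wlength t' w' ->
       window k w t = window k w' t' ->
       dsp_val dt phi t w = dsp_val dt phi t' w').
Proof.
have dt0 : dt != 0 by rewrite gt_eqF.
split=> [P PS|phi ordphi w w' t t' _ _ kt _ kt' _ eqw]; last first.
  by apply: eq_dsp_val; rewrite ordphi; apply/window_dderivP.
have /finite_seqP[s Ps] := sub_finite_set PS (finite_tuples_over k.+1 finS).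
(* The formula singling out [p]: its prescribed values are the derivatives of [p] itself, read as a
   word of length [k.+1]. *)
pose chi (p : k.+1.-tuple 'rV[R]_d) :=
  dderivs_eq k (fun j => dderiv dt j (FinWord p) k.+1).
exists (dsp_some k chi s); split=> [|w t _ kt _].
  by apply: dsp_ord_some => p; exact: dsp_ord_dderivs_eq.
have chiP p : dsp_val dt (chi p) t w <-> window k w t = p.
  (* Only the right-hand [p] becomes a window, so that two windows are compared, at [t] in [w] and
     at [k.+1] in [FinWord p]. *)
  rewrite dsp_val_dderivs_eq -{2}(window_FinWord p).
  by rewrite (window_dderivP w (FinWord p) dt0 kt (ltnSn k)).
rewrite dsp_val_some Ps; split=> [/hasP[p ps /chiP->] //|ws].
by apply/hasP; exists (window k w t) => //; apply/chiP.
Qed.
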